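(* Let $I(QI_2)$ and $I(Mix_2)$ be the homogeneous ideals in $\mathbb{C}[P_{ijk} : 1\le i,j,k\le 2]$ of the projective varieties $V_{QI_2}, V_{Mix_2}\subset\mathbb{P}^7$. Then $I(QI_2)=I(Mix_2)$, and this ideal is generated by the two binomials $$P_{121}P_{212}-P_{112}P_{221},\qquad P_{122}P_{211}-P_{121}P_{212},$$ both of which are invariants of the complete independence model, i.e. belong to the homogeneous ideal of the Segre variety $X_{1,1,1}\subset\mathbb{P}^7$.
   Context: We work over $\mathbb{C}$. The projective space $\mathbb{P}^{7}$ has homogeneous coordinates $P_{ijk}$, $1\le i,j,k\le 2$, so its points are nonzero $2\times2\times2$ tensors up to scaling. The ''invariants'' of a model are the generators of the homogeneous ideal of the associated projective variety. $X_{1,1,1}$ is the Segre embedding of $\mathbb{P}^1\times\mathbb{P}^1\times\mathbb{P}^1$ in $\mathbb{P}^7$, i.e. the set of points with $P_{ijk}=a_ib_jc_k$; it is the variety of the complete independence model. The variety of the quasi-independence model is $V_{QI_2}=X_{1,1,1}\star\mathcal{H}$, where $\mathcal{H}\subset\mathbb{P}^7$ is the linear variety of tensors all of whose non-diagonal entries ($P_{ijk}$ with $i,j,k$ not all equal) are equal to each other, the diagonal entries $P_{111},P_{222}$ being arbitrary. Here the Hadamard product $X\star Y$ of two projective varieties in the same projective space is the Zariski closure of the set of all coordinatewise products $p\star q$ with $p\in X$, $q\in Y$ that are not identically zero. (This corresponds to the parametrization $P_{iii}=\zeta\gamma_ia_ib_ic_i$ and $P_{ijk}=\zeta a_ib_jc_k$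 for $i,j,k$ not all equal.) The variety of the mixture model is the join $V_{Mix_2}=J(X_{1,1,1},\mathcal{D})$, where $\mathcal{D}\subset\mathbb{P}^7$ is the linear variety of diagonal tensors ($P_{ijk}=0$ whenever $i,j,k$ are not all equal), and $J(X,Y)$ is the Zariski closure of $\{\lambda Q+\mu R: Q\in X, R\in Y,\lambda,\mu\in\mathbb{C}^*\}$. (This corresponds to the parametrization $P_{iii}=\alpha a_ib_ic_i+(1-\alpha)d_i$ and $P_{ijk}=\alpha a_ib_jc_k$ for $i,j,k$ not all equal.) *)

(* Defs.v *)
From HB Require Import structures.
From mathcomp Require Import all_boot all_order all_algebra.
From mathcomp Require Import mpoly complex.
From mathcomp Require Import classical_sets reals.

Set Implicit Arguments.
Unset Strict Implicit.
Unset Printing Implicit Defensive.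

Import GRing.Theory.
Local Open Scope ring_scope.
Local Open Scope classical_set_scope.

(* The labels 1, 2 of the tensor indices are the elements 0, 1 of 'I_2. *)
Notation tindex := ('I_2 * 'I_2 * 'I_2)%type.

Notation tensor K := {ffun tindex -> K}.

Notation tpoly K := {mpoly K[#|{: tindex}|]}.

Section Projective.
Variable K : fieldType.

Definition Pvar (i j k : 'I_2) : tpoly K := 'X_(enum_rank (i, j, k)).

Definition teval (f : tpoly K) (p : tensor K) : K :=
  f.@[fun v => p (enum_val v)].

Definition homogeneous (f : tpoly K) : Prop := exists d : nat, f \is d.-homog.

(* A subset of P^7 is represented by the set of all homogeneous coordinate
   vectors of its points: a set of nonzero tensors stable under nonzero
   scaling. *)
Definition projective_zeros (F : set (tpoly K)) : set (tensor K) :=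
  [set p : tensor K | p != 0 /\ forall f, F f -> teval f p = 0].

Definition zariski_closed (V : set (tensor K)) : Prop :=
  exists2 F : set (tpoly K), F `<=` homogeneous & V = projective_zeros F.

Definition zariski_closure (S : set (tensor K)) : set (tensor K) :=
  smallest zariski_closed S.

(* ring_quotient's [idealr_closed] is not used: it requires a proper ideal. *)
Definition is_ideal (I : set (tpoly K)) : Prop :=
  [/\ I 0, forall f g, I f -> I g -> I (f + g)
    & forall h f, I f -> I (h * f)].

Definition ideal_generated (G : set (tpoly K)) : set (tpoly K) :=
  smallest is_ideal G.

Definition homogeneous_ideal (V : set (tensor K)) : set (tpoly K) :=
  ideal_generated
    [set f | homogeneous f /\ forall p, V p -> teval f p = 0].

Definition tensor_mul (p q : tensor K) : tensor K := [ffun t => p t * q t].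

Definition hadamard_product (X Y : set (tensor K)) : set (tensor K) :=
  zariski_closure
    [set r : tensor K | r != 0 /\
       exists p q, [/\ X p, Y q & r = tensor_mul p q]].

(* The combination is required to be nonzero, so that it is a point of P^7. *)
Definition join_variety (X Y : set (tensor K)) : set (tensor K) :=
  zariski_closure
    [set r : tensor K | r != 0 /\ exists p q, exists a b : K,
       [/\ X p, Y q, a != 0, b != 0 & r = [ffun t => a * p t + b * q t]]].

Definition diagonal (t : tindex) : bool :=
  (t.1.1 == t.1.2) && (t.1.2 == t.2).

Definition segre : set (tensor K) :=
  [set p : tensor K | p != 0 /\ exists a b c : 'I_2 -> K,
     forall i j k, p (i, j, k) = a i * b j * c k].

Definition equal_offdiagonal : set (tensor K) :=
  [set p : tensor K | p != 0 /\
     forall s t, ~~ diagonal s -> ~~ diagonal t -> p s = p t].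

Definition diagonal_tensors : set (tensor K) :=
  [set p : tensor K | p != 0 /\ forall t, ~~ diagonal t -> p t = 0].

Definition V_QI : set (tensor K) := hadamard_product segre equal_offdiagonal.

Definition V_Mix : set (tensor K) := join_variety segre diagonal_tensors.

End Projective.

(* Main.v *)
(* Modulo the two binomials, every monomial is congruent to a normal one, where
   P001 P110 and P011 P100 have been traded for P010 P101 as often as possible.
   For a large base B, sending each variable to a suitable power of t separates
   the normal monomials of bounded degree, and the resulting curve of tensors
   lies in both parametrized families.  A polynomial f vanishing on either family
   therefore vanishes identically in t; collecting powers of t shows that its
   normal form is zero, so f lies in the ideal of the binomials. *)
Require Import Defs.
From mathcomp Require Import all_boot all_order all_algebra.
From mathcomp Require Import mpoly complex.
From mathcomp Require Import classical_sets reals.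
From mathcomp Require Import zify ring.

Import Order.TTheory GRing.Theory Num.Theory.
Local Open Scope ring_scope.
Local Open Scope classical_set_scope.

(* [classical_sets] shadows the predicate of Defs. *)
Local Notation diagonal := Defs.diagonal.

(** * Case analysis over the eight tensor indices *)

Lemma tindexW (P : tindex -> Prop) :
  P (0, 0, 0) -> P (0, 0, 1) -> P (0, 1, 0) -> P (0, 1, 1) ->
  P (1, 0, 0) -> P (1, 0, 1) -> P (1, 1, 0) -> P (1, 1, 1) -> forall t, P t.
Proof.
have ord2 (i : 'I_2) : i = 0 \/ i = 1.
  by case: i => [[|[|//]]] h; [left | right]; apply: val_inj.
move=> ? ? ? ? ? ? ? ? [[i j] k].
by case: (ord2 i) => ->; case: (ord2 j) => ->; case: (ord2 k) => ->.
Qed.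

Lemma big_tindex (T : Type) (idx : T) (op : Monoid.com_law idx)
    (F : tindex -> T) :
  \big[op/idx]_t F t =
  op (op (op (F (0, 0, 0)) (F (0, 0, 1))) (op (F (0, 1, 0)) (F (0, 1, 1))))
     (op (op (F (1, 0, 0)) (F (1, 0, 1))) (op (F (1, 1, 0)) (F (1, 1, 1)))).
Proof.
have big2 (G : 'I_2 -> T) : \big[op/idx]_i G i = op (G 0) (G 1).
  rewrite !big_ord_recl big_ord0 Monoid.mulm1.
  by congr (op _ (G _)); apply: val_inj.
have -> : \big[op/idx]_t F t =
    \big[op/idx]_(p : 'I_2 * 'I_2) \big[op/idx]_k F (p, k).
  by rewrite pair_bigA; apply: eq_bigr => -[].
have -> : \big[op/idx]_(p : 'I_2 * 'I_2) \big[op/idx]_k F (p, k) =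
    \big[op/idx]_i \big[op/idx]_j \big[op/idx]_k F (i, j, k).
  rewrite (pair_bigA _ (fun i j => \big[op/idx]_k F (i, j, k))).
  by apply: eq_bigr => -[].
by rewrite !big2.
Qed.

(** Nested tests make every lookup at a concrete index reduce by computation. *)
Definition cells {T : Type} (x000 x001 x010 x011 x100 x101 x110 x111 : T)
    (t : tindex) : T :=
  if t.1.1 == 0 then
    if t.1.2 == 0 then if t.2 == 0 then x000 else x001
    else if t.2 == 0 then x010 else x011
  else
    if t.1.2 == 0 then if t.2 == 0 then x100 else x101
    else if t.2 == 0 then x110 else x111.

Lemma cellsE (T : Type) (x000 x001 x010 x011 x100 x101 x110 x111 : T) :
  let c := cells x000 x001 x010 x011 x100 x101 x110 x111 in
  ((c (0, 0, 0) = x000) * (c (0, 0, 1) = x001) *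
   (c (0, 1, 0) = x010) * (c (0, 1, 1) = x011) *
   (c (1, 0, 0) = x100) * (c (1, 0, 1) = x101) *
   (c (1, 1, 0) = x110) * (c (1, 1, 1) = x111))%type.
Proof. by []. Qed.

(** * Normal monomials and the weights separating them *)

Local Notation exponent m t := ((m : 'X_{1.. _}) (enum_rank (t : tindex))).

Section NormalForm.
Local Open Scope nat_scope.

(** [r] and [s] count the pairs P001 P110 and P011 P100 that get traded. *)
Definition normal_exponents (e : tindex -> nat) : tindex -> nat :=
  let r := minn (e (0, 0, 1)%R) (e (1, 1, 0)%R) in
  let s := minn (e (0, 1, 1)%R) (e (1, 0, 0)%R) in
  cells (e (0, 0, 0)%R) (e (0, 0, 1)%R - r) (e (0, 1, 0)%R + r + s)
    (e (0, 1, 1)%R - s) (e (1, 0, 0)%R - s) (e (1, 0, 1)%R + r + s)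
    (e (1, 1, 0)%R - r) (e (1, 1, 1)%R).

Definition normal_form (m : 'X_{1.. #|{: tindex}|}) : 'X_{1.. #|{: tindex}|} :=
  [multinom normal_exponents (fun t => exponent m t) (enum_val v) | v < _].

Lemma normal_formE m t :
  exponent (normal_form m) t = normal_exponents (fun s => exponent m s) t.
Proof. by rewrite mnmE enum_rankK. Qed.

(* The three weight sums w010 + w101, w001 + w110 and w011 + w100 all equal
   [B ^ 2 + B ^ 3]; otherwise the weights are independent powers of [B]. *)
Definition weight (B : nat) : tindex -> nat :=
  cells (B ^ 4) B (B ^ 2) 1 (B ^ 2 + B ^ 3 - 1) (B ^ 3) (B ^ 2 + B ^ 3 - B)
    (B ^ 5).

Definition weighted_degree (B : nat) (m : 'X_{1.. #|{: tindex}|}) : nat :=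
  \sum_t weight B t * exponent m t.

(** Expansion in base [B]. The terms that the weights subtract stand on the left, which keeps the
    identity within the natural numbers. *)
Lemma weighted_degree_digits (B : nat) m : 0 < B ->
  weighted_degree B m + B * exponent m (1, 1, 0)%R + exponent m (1, 0, 0)%R =
  exponent m (0, 1, 1)%R + B * (exponent m (0, 0, 1)%R +
    B * ((exponent m (0, 1, 0)%R + exponent m (1, 1, 0)%R
          + exponent m (1, 0, 0)%R) +
    B * ((exponent m (1, 0, 1)%R + exponent m (1, 1, 0)%R
          + exponent m (1, 0, 0)%R) +
    B * (exponent m (0, 0, 0)%R + B * exponent m (1, 1, 1)%R)))).
Proof.
move=> B0; rewrite /weighted_degree big_tindex /weight !cellsE.
have h1 : B ^ 2 + B ^ 3 - B + B = B ^ 2 + B ^ 3 by apply: subnK; nia.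
have h2 : B ^ 2 + B ^ 3 - 1 + 1 = B ^ 2 + B ^ 3 by apply: subnK; nia.
move: (B ^ 2 + B ^ 3 - B) (B ^ 2 + B ^ 3 - 1) h1 h2 => w w'.
rewrite !expnS expn0 !muln1 => h1 h2.
have := congr1 (fun x => x * exponent m (1, 1, 0)%R) h1.
have := congr1 (fun x => x * exponent m (1, 0, 0)%R) h2.
rewrite /= !mulnDl !mulnDr.
lia.
Qed.

(** Peels the lowest digit off a base [B] expansion of zero with signed digits: a nonzero [k] would
    make [B * k] too large to be cancelled by [a]. *)
Lemma digit0 (B a k : int) :
  (`|a| < B -> a + B * k = 0 -> a = 0 /\ k = 0)%R.
Proof.
move=> aB h.
have [k1|k1|k0] := ltrgtP k 0%R.
- have : (B * k <= - B)%R by nia.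
  lia.
- have : (B <= B * k)%R by nia.
  lia.
- by rewrite k0 mulr0 addr0 in h *.
Qed.

(** The quantities compared on the right are invariant under each trade, differences being written
    additively. They determine the normal form, where one member of each traded pair has exponent
    zero. *)
Lemma eq_normal_exponents (e e' : tindex -> nat) :
  normal_exponents e =1 normal_exponents e' <->
  [/\ e (0, 0, 0)%R = e' (0, 0, 0)%R,
      e (0, 0, 1)%R + e' (1, 1, 0)%R = e' (0, 0, 1)%R + e (1, 1, 0)%R,
      e (0, 1, 1)%R + e' (1, 0, 0)%R = e' (0, 1, 1)%R + e (1, 0, 0)%R,
      e (1, 1, 1)%R = e' (1, 1, 1)%R &
      e (0, 1, 0)%R + e (1, 1, 0)%R + e (1, 0, 0)%R =
        e' (0, 1, 0)%R + e' (1, 1, 0)%R + e' (1, 0, 0)%R /\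
      e (1, 0, 1)%R + e (1, 1, 0)%R + e (1, 0, 0)%R =
        e' (1, 0, 1)%R + e' (1, 1, 0)%R + e' (1, 0, 0)%R].
Proof.
split=> [h|].
  have := (h (0,0,0)%R, (h (0,0,1)%R, h (1,1,0)%R), (h (0,1,1)%R, h (1,0,0)%R),
    h (0,1,0)%R, h (1,0,1)%R, h (1,1,1)%R).
  rewrite /normal_exponents !cellsE.
  move: (e (0,0,1)%R) (e (0,1,0)%R) (e (0,1,1)%R) (e (1,0,0)%R)
    (e (1,0,1)%R) (e (1,1,0)%R) => b c d p q r.
  move: (e' (0,0,1)%R) (e' (0,1,0)%R) (e' (0,1,1)%R) (e' (1,0,0)%R)
    (e' (1,0,1)%R) (e' (1,1,0)%R) => b' c' d' p' q' r'.
  move=> [[[[[-> [h1 h2]] [h3 h4]] h5] h6] ->].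
  have br : b + r' = b' + r by clear -h1 h2; lia.
  have dp : d + p' = d' + p by clear -h3 h4; lia.
  by split=> //; clear h h1 h2 h3 h4; split; lia.
move=> [ha hbr hdp hv [hc hq]].
apply: tindexW; rewrite /normal_exponents !cellsE.
all: move: ha hbr hdp hv hc hq.
all: move: (e (0,0,0)%R) (e (0,0,1)%R) (e (0,1,0)%R) (e (0,1,1)%R)
  (e (1,0,0)%R) (e (1,0,1)%R) (e (1,1,0)%R) (e (1,1,1)%R) => a b c d p q r v.
all: move: (e' (0,0,0)%R) (e' (0,0,1)%R) (e' (0,1,0)%R) (e' (0,1,1)%R)
  (e' (1,0,0)%R) (e' (1,0,1)%R) (e' (1,1,0)%R) (e' (1,1,1)%R)
  => a' b' c' d' p' q' r' v'.
all: move=> ha hbr hdp hv hc hq.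
- exact: ha.
- by clear -hbr; lia.
- by clear -hbr hdp hc; lia.
- by clear -hdp; lia.
- by clear -hdp; lia.
- by clear -hbr hdp hq; lia.
- by clear -hbr; lia.
- exact: hv.
Qed.

(** The base [B] digits are the trade invariants. Two monomials have digits differing by at most
    [3 * d], hence by less than [B], so no carry can occur. *)
Lemma weighted_degree_inj (B d : nat) (m n : 'X_{1.. #|{: tindex}|}) :
  4 * d < B -> (forall t, exponent m t <= d) -> (forall t, exponent n t <= d) ->
  (weighted_degree B m == weighted_degree B n) = (normal_form m == normal_form n).
Proof.
move=> dB md nd; have B0 : 0 < B by lia.
have nfE : normal_form m = normal_form n <->
    normal_exponents (fun s => exponent m s) =1
    normal_exponents (fun s => exponent n s).
  split=> [h t|h]; first by rewrite -!normal_formE h.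
  by apply/mnmP => v; rewrite -[v]enum_valK !normal_formE.
apply/eqP/eqP; rewrite nfE eq_normal_exponents.
all: have := weighted_degree_digits _ m B0.
all: have := weighted_degree_digits _ n B0.
all: move: (weighted_degree B m) (weighted_degree B n) => wm wn.
all: move: (md (0,0,0)%R) (md (0,0,1)%R) (md (0,1,0)%R) (md (0,1,1)%R)
  (md (1,0,0)%R) (md (1,0,1)%R) (md (1,1,0)%R) (md (1,1,1)%R).
all: move: (exponent m (0,0,0)%R) (exponent m (0,0,1)%R) (exponent m (0,1,0)%R)
  (exponent m (0,1,1)%R) (exponent m (1,0,0)%R) (exponent m (1,0,1)%R)
  (exponent m (1,1,0)%R) (exponent m (1,1,1)%R) => a0 a1 a2 a3 a4 a5 a6 a7.
all: move=> ? ? ? ? ? ? ? ?.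
all: move: (nd (0,0,0)%R) (nd (0,0,1)%R) (nd (0,1,0)%R) (nd (0,1,1)%R)
  (nd (1,0,0)%R) (nd (1,0,1)%R) (nd (1,1,0)%R) (nd (1,1,1)%R).
all: move: (exponent n (0,0,0)%R) (exponent n (0,0,1)%R) (exponent n (0,1,0)%R)
  (exponent n (0,1,1)%R) (exponent n (1,0,0)%R) (exponent n (1,0,1)%R)
  (exponent n (1,1,0)%R) (exponent n (1,1,1)%R) => b0 b1 b2 b3 b4 b5 b6 b7.
all: move=> ? ? ? ? ? ? ? ? en em; clear md nd nfE.
  move=> wmn; subst wn.
  (* Over the integers, the difference of the two expansions is an expansion of zero. *)
  have {en em} : (((a3%:Z - b3%:Z) - (a4%:Z - b4%:Z)) + B%:Z *
     (((a1%:Z - b1%:Z) - (a6%:Z - b6%:Z)) + B%:Z *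
     (((a2%:Z - b2%:Z) + (a6%:Z - b6%:Z) + (a4%:Z - b4%:Z)) + B%:Z *
     (((a5%:Z - b5%:Z) + (a6%:Z - b6%:Z) + (a4%:Z - b4%:Z)) + B%:Z *
     ((a0%:Z - b0%:Z) + B%:Z * (a7%:Z - b7%:Z))))) = 0)%R.
    by clear -en em; lia.
  case/digit0 => [|h1]; first by lia.
  case/digit0 => [|h2]; first by lia.
  case/digit0 => [|h3]; first by lia.
  case/digit0 => [|h4]; first by lia.
  case/digit0 => [|h5 h6]; first by lia.
  by split; [lia .. | split; lia].
move=> [h0 hy hz h7 [h2 h5]]; move: em en; rewrite h0 h2 h5 h7.
(* The invariant in [hy] is the digit of [B], so it enters the expansions multiplied by [B]. *)
by have := congr1 (muln B) hy; clear -hz; lia.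
Qed.

End NormalForm.

(** The factors are bracketed as in [big_tindex]. Once the common cofactor is extracted, only powers
    of the traded pairs [y * y'], [z * z'] and of [x * x'] remain to be compared. *)
Lemma monomial_split (A : comNzRingType) (u y x z z' x' y' v : A)
    (a b c d e f g h r s : nat) :
  (r <= b)%N -> (r <= g)%N -> (s <= d)%N -> (s <= e)%N ->
  u ^+ a * y ^+ b * (x ^+ c * z ^+ d) * (z' ^+ e * x' ^+ f * (y' ^+ g * v ^+ h))
  - u ^+ a * y ^+ (b - r) * (x ^+ (c + r + s) * z ^+ (d - s)) *
    (z' ^+ (e - s) * x' ^+ (f + r + s) * (y' ^+ (g - r) * v ^+ h)) =
  u ^+ a * y ^+ (b - r) * x ^+ c * z ^+ (d - s) * z' ^+ (e - s) * x' ^+ f *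
  y' ^+ (g - r) * v ^+ h *
  ((y * y') ^+ r * (z * z') ^+ s - (x * x') ^+ r * (x * x') ^+ s).
Proof.
move=> rb rg sd se.
have split_exp (p : A) i j : (j <= i)%N -> p ^+ i = p ^+ (i - j) * p ^+ j.
  by move=> ji; rewrite -exprD subnK.
rewrite (split_exp y _ _ rb) (split_exp y' _ _ rg) (split_exp z _ _ sd).
rewrite (split_exp z' _ _ se) !exprD !exprMn.
move: (y ^+ r) (y' ^+ r) (z ^+ s) (z' ^+ s) (x ^+ r) (x' ^+ r) (x ^+ s) (x' ^+ s).
move: (y ^+ _) (y' ^+ _) (z ^+ _) (z' ^+ _) (u ^+ _) (v ^+ _) (x ^+ c) (x' ^+ f).
by move=> *; ring.
Qed.

(** * Congruence modulo an ideal containing the binomials *)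

Section VanishingIdeal.
Variable K : numFieldType.
Local Notation P := (@Pvar K).

Definition binomial1 : tpoly K := P 0 1 0 * P 1 0 1 - P 0 0 1 * P 1 1 0.
Definition binomial2 : tpoly K := P 0 1 1 * P 1 0 0 - P 0 1 0 * P 1 0 1.

Lemma ideal_generated_ideal (G : set (tpoly K)) : is_ideal (ideal_generated G).
Proof.
split=> [J [[]] //|f g If Ig J GJ|h f If J GJ].
  by case: (GJ) => -[_ JD _] _; apply: JD; [apply: If | apply: Ig].
by case: (GJ) => -[_ _ JM] _; apply: JM; apply: If.
Qed.

Section Congruence.
Variables (I : set (tpoly K)) (idealI : is_ideal I).

Lemma ideal_congrM (a b c d : tpoly K) :
  I (a - b) -> I (c - d) -> I (a * c - b * d).
Proof.
case: idealI => _ ID IM Iab Icd.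
have -> : a * c - b * d = c * (a - b) + b * (c - d) by ring.
by apply: ID; apply: IM.
Qed.

Lemma ideal_congrX (a b : tpoly K) n : I (a - b) -> I (a ^+ n - b ^+ n).
Proof.
move=> Iab; elim: n => [|n IH]; first by rewrite !expr0 subrr; case: idealI.
by rewrite !exprS; apply: ideal_congrM.
Qed.

Lemma ideal_sum (T : eqType) (r : seq T) (F : T -> tpoly K) :
  (forall i, i \in r -> I (F i)) -> I (\sum_(i <- r) F i).
Proof.
case: idealI => I0 ID _ IF; rewrite big_seq.
by elim/big_ind: _.
Qed.

Lemma mpolyX_tindex (m : 'X_{1.. #|{: tindex}|}) :
  'X_[m] = \prod_t P t.1.1 t.1.2 t.2 ^+ exponent m t.
Proof.
rewrite mpolyXE_id (reindex (@enum_rank tindex)) /=; last first.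
  by apply: onW_bij; exact: enum_rank_bij.
by apply: eq_bigr => -[[i j] k].
Qed.

Hypotheses (Ib1 : I binomial1) (Ib2 : I binomial2).

Lemma normal_form_congr m : I ('X_[m] - 'X_[normal_form m]).
Proof.
case: (idealI) => I0 ID IM.
rewrite !mpolyX_tindex !big_tindex /= !normal_formE /normal_exponents !cellsE.
rewrite monomial_split; first apply: (IM); rewrite ?geq_minl ?geq_minr //.
apply: ideal_congrM; apply: ideal_congrX; last exact: Ib2.
(* [binomial1] has the sign opposite to the congruence required here. *)
by have := IM (-1) _ Ib1; rewrite mulN1r opprB.
Qed.

(** * Polynomials vanishing on the monomial curves *)

Definition monomial_curve (B n : nat) : tensor K :=
  [ffun t => n.+2%:R ^+ weight B t].

(** In characteristic zero these are infinitely many roots. Starting at 2 avoids the parameters 0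
    and 1, whose powers are not distinct. *)
Lemma poly_eq0_nat (p : {poly K}) : (forall n : nat, p.[n.+2%:R] = 0) -> p = 0.
Proof.
move=> p0; apply: (@roots_geq_poly_eq0 _ _ [seq n.+2%:R | n <- iota 0 (size p)]).
- by apply/allP => _ /mapP[n _ ->]; apply/rootP.
- by rewrite map_inj_uniq ?iota_uniq // => i j /mulrIn-/(_ (oner_neq0 _)) [].
- by rewrite size_map size_iota.
Qed.

Lemma mem_ideal_of_curves (f : tpoly K) :
  (forall B n : nat, (1 < B)%N -> teval f (monomial_curve B n) = 0) -> I f.
Proof.
(* [msize f] bounds all exponents in [f], so this base meets the bound of [weighted_degree_inj]. *)
move=> f0; pose B := (4 * msize f).+2; have B1 : (1 < B)%N by [].
have small m : m \in msupp f -> forall t, (exponent m t <= msize f)%N.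
  move=> /msize_mdeg_lt mf t; apply: leq_trans (ltnW mf).
  by rewrite mdegE (bigD1 (enum_rank t)) //= leq_addr.
(* [phi] is [f] restricted to the curve, as a polynomial in its parameter. *)
pose phi : {poly K} := \sum_(m <- msupp f) f@_m *: 'X^(weighted_degree B m).
have phi0 : phi = 0.
  apply: poly_eq0_nat => n; rewrite -(f0 B n B1) /teval mevalE horner_sum.
  apply: eq_bigr => m _; rewrite hornerZ hornerXn; congr (_ * _).
  rewrite /weighted_degree -prodrXr.
  rewrite (reindex (@enum_rank tindex)) /=; last first.
    by apply: onW_bij; exact: enum_rank_bij.
  by apply: eq_bigr => t _; rewrite enum_rankK ffunE exprM.
(* [g] is the normal form of [f], congruent to it term by term. *)
pose g : tpoly K := \sum_(m <- msupp f) f@_m *: 'X_[normal_form m].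
suff g0 : g = 0.
  have -> : f = \sum_(m <- msupp f)
                  (f@_m *: 'X_[m] - f@_m *: 'X_[normal_form m]).
    by rewrite sumrB -/g g0 subr0 -mpolyE.
  apply: ideal_sum => m _.
  rewrite -scalerBr -mul_mpolyC; case: idealI => _ _; apply.
  exact: normal_form_congr.
apply/mpolyP => k; rewrite mcoeff0 raddf_sum /=.
have [/hasP[m0 fm0 /eqP <-]|/hasPn nk] :=
    boolP (has (fun m => normal_form m == k) (msupp f)); last first.
  rewrite big_seq big1 // => m /nk /negbTE mk.
  by rewrite mcoeffZ mcoeffX mk mulr0.
(* The same terms of [f] contribute to this coefficient of [phi] and to that of [g] at
   [normal_form m0]. *)
have := congr1 (fun p : {poly K} => p`_(weighted_degree B m0)) phi0.
rewrite coef0 coef_sum; apply: etrans; rewrite [LHS]big_seq [RHS]big_seq.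
apply: eq_bigr => m fm; rewrite mcoeffZ mcoeffX coefZ coefXn eq_sym.
by rewrite (weighted_degree_inj _ (msize f) m0 m) //; apply: small.
Qed.

End Congruence.

(** * The ideal of a Zariski closure, and the Segre variety *)

Lemma teval_Pvar i j k (p : tensor K) : teval (P i j k) p = p (i, j, k).
Proof. by rewrite /teval mevalXU enum_rankK. Qed.

Lemma teval_binomial1 (p : tensor K) : teval binomial1 p =
  p (0, 1, 0) * p (1, 0, 1) - p (0, 0, 1) * p (1, 1, 0).
Proof. by rewrite -!teval_Pvar /teval mevalB !mevalM. Qed.

Lemma teval_binomial2 (p : tensor K) : teval binomial2 p =
  p (0, 1, 1) * p (1, 0, 0) - p (0, 1, 0) * p (1, 0, 1).
Proof. by rewrite -!teval_Pvar /teval mevalB !mevalM. Qed.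

Lemma homogeneous_binomials : [set binomial1; binomial2] `<=` @homogeneous K.
Proof.
have PP i j k i' j' k' : P i j k * P i' j' k' \is 2.-homog.
  by apply: (@dhomogM _ _ _ 1 _ 1); rewrite dhomogX /= mdeg1.
by move=> _ [|] ->; exists 2%N; apply: rpredB.
Qed.

(** Common criterion for the two models: the curves bound the ideal from above, the equations of [S]
    from below. *)
Lemma homogeneous_ideal_closure (S : set (tensor K)) :
  S `<=` projective_zeros [set binomial1; binomial2] ->
  (forall B n : nat, (1 < B)%N -> S (monomial_curve B n)) ->
  homogeneous_ideal (zariski_closure S) =
  ideal_generated [set binomial1; binomial2].
Proof.
move=> S0 Sc; apply/seteqP; split; apply: smallest_sub.
- exact: ideal_generated_ideal.
- move=> f [_ f0]; apply: mem_ideal_of_curves.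
  + exact: ideal_generated_ideal.
  + by apply: sub_gen_smallest; left.
  + by apply: sub_gen_smallest; right.
  + by move=> B n B1; apply: f0; apply: sub_gen_smallest; apply: Sc.
- exact: ideal_generated_ideal.
- move=> f bf; apply: sub_gen_smallest; split; first exact: homogeneous_binomials.
  move=> p Vp.
  (* The zero set of the binomials is closed and contains [S], hence also its closure. *)
  suff [_ /(_ _ bf)] : projective_zeros [set binomial1; binomial2] p by [].
  apply: Vp; split=> //.
  by exists [set binomial1; binomial2] => //; exact: homogeneous_binomials.
Qed.

Lemma segre_binomials : @segre K `<=` projective_zeros [set binomial1; binomial2].
Proof.
move=> p [p0 [a [b [c pE]]]]; split=> // _ [|] ->.
  by rewrite teval_binomial1 !pE; ring.
by rewrite teval_binomial2 !pE; ring.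
Qed.

Lemma segre_ideal_binomials :
  [set binomial1; binomial2] `<=` homogeneous_ideal (@segre K).
Proof.
move=> f bf; apply: sub_gen_smallest; split; first exact: homogeneous_binomials.
by move=> p /segre_binomials[_ /(_ f bf)].
Qed.

(* On the torus, [P001, P010, P011, P101] determine a point of the Segre cone;
   the other two off-diagonal entries then agree because of the weights. *)
Lemma monomial_curve_segre (B n : nat) : (1 < B)%N -> exists p : tensor K,
  [/\ segre p, forall t, p t != 0,
      forall t, ~~ diagonal t -> p t = monomial_curve B n t
    & p (0, 0, 0) != monomial_curve B n (0, 0, 0)].
Proof.
move=> B1; move tE : (n.+2%:R : K) => t.
have t0 : t != 0 by rewrite -tE pnatr_eq0.
have tX k : t ^+ k != 0 by rewrite expf_neq0.
(* With [a 0 = b 0 = 1], the entries give [c 1] = P001, [b 1] = P011 / P001, [a 1] = P101 / P001 and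
   [c 0] = P010 / [b 1]. *)
pose a (i : 'I_2) : K := if i == 0 then 1 else t ^+ (B ^ 3) / t ^+ B.
pose b (i : 'I_2) : K := if i == 0 then 1 else t / t ^+ B.
pose c (i : 'I_2) : K := if i == 0 then t ^+ (B ^ 2) * t ^+ B / t else t ^+ B.
have a0 i : a i != 0.
  by rewrite /a; case: ifP; rewrite ?oner_neq0 ?mulf_neq0 ?invr_eq0.
have b0 i : b i != 0.
  by rewrite /b; case: ifP; rewrite ?oner_neq0 ?mulf_neq0 ?invr_eq0.
have c0 i : c i != 0 by rewrite /c; case: ifP; rewrite ?mulf_neq0 ?invr_eq0.
pose p : tensor K := [ffun s => a s.1.1 * b s.1.2 * c s.2].
have p0 s : p s != 0 by rewrite ffunE !mulf_neq0.
have le1 : (1 <= B ^ 2 + B ^ 3)%N by rewrite addn_gt0 expn_gt0 ltnW.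
have leB : (B <= B ^ 2 + B ^ 3)%N.
  by rewrite (leq_trans _ (leq_addr _ _)) // leq_pmulr // ltnW.
exists p; split=> //.
- split; last by exists a, b, c => i j k; rewrite ffunE.
  by apply: contraNneq (p0 (0, 0, 0)) => ->; rewrite ffunE.
- apply: tindexW => // _; rewrite !ffunE /weight !cellsE /a /b /c /= tE.
  + by rewrite !mul1r.
  + by field; rewrite ?t0 ?tX.
  + by rewrite expr1; field; rewrite ?t0 ?tX.
  (* This weight is a truncated difference; multiplying by [t] (by [t ^+ B] for P110) restores the
     sum. *)
  + apply: (mulIf t0); rewrite -[RHS]exprSr subn1 prednK // exprD.
    by field; rewrite ?t0 ?tX.
  + by field; rewrite ?t0 ?tX.
  + apply: (mulIf (tX B)); rewrite -[RHS]exprD subnK // exprD.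
    by field; rewrite ?t0 ?tX.
(* The two entries are powers of [t] with exponents [B ^ 2 + B - 1] and [B ^ 4], the former being
   smaller. *)
- rewrite !ffunE /weight !cellsE /a /b /c /= tE !mul1r.
  rewrite -(inj_eq (mulIf t0)) divfK // -exprSr -exprD.
  have tI : injective (GRing.exp t).
    by apply: ieexprIn; rewrite -tE ?ltr0n ?pnatr_eq1.
  rewrite (inj_eq tI).
  rewrite neq_ltn; apply/orP; left; rewrite ltnS.
  have : (B ^ 4 = B ^ 2 * B ^ 2)%N by rewrite -expnD.
  have : (B * 2 <= B ^ 2)%N by rewrite expnS expn1 leq_mul2l B1 orbT.
  nia.
Qed.

(** * The ideals of the two models *)

Lemma monomial_curve_neq0 (B n : nat) : monomial_curve B n != 0.
Proof.
have : monomial_curve B n (0, 0, 0) != 0 by rewrite ffunE expf_neq0 // pnatr_eq0.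
by apply: contraNneq => ->; rewrite ffunE.
Qed.

Lemma homogeneous_ideal_V_QI :
  homogeneous_ideal (@V_QI K) = ideal_generated [set binomial1; binomial2].
Proof.
apply: homogeneous_ideal_closure => [r [r0 [p [q [Xp [_ qE] rE]]]]|B n B1].
  split=> // f bf; have [_ /(_ f bf)] := segre_binomials p Xp.
  (* The binomials are off-diagonal quadrics, so [q] only scales their values by the square of a
     constant. *)
  have q1 t : ~~ diagonal t -> q t = q (0, 0, 1) by move=> dt; apply: qE.
  case: bf => ->; rewrite (teval_binomial1, teval_binomial2) => h.
    rewrite teval_binomial1 rE !ffunE.
    rewrite !(q1 (0, 1, 0), q1 (1, 0, 1), q1 (1, 1, 0)) //.
    by rewrite -[RHS](mulr0 (q (0, 0, 1) ^+ 2)) -h; ring.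
  rewrite teval_binomial2 rE !ffunE.
  rewrite !(q1 (0, 1, 1), q1 (1, 0, 0), q1 (0, 1, 0), q1 (1, 0, 1)) //.
  by rewrite -[RHS](mulr0 (q (0, 0, 1) ^+ 2)) -h; ring.
split; first exact: monomial_curve_neq0.
have [p [Xp p0 pE _]] := monomial_curve_segre B n B1.
(* The second factor corrects the diagonal of [p], which has no zero entry. *)
exists p, [ffun t => if diagonal t then monomial_curve B n t / p t else 1].
split=> //; first split.
- apply/eqP => /(congr1 (fun q : tensor K => q (0, 0, 1))); rewrite !ffunE /=.
  by apply/eqP; exact: oner_neq0.
- by move=> s t /negbTE ds /negbTE dt; rewrite !ffunE ds dt.
- apply/ffunP => t; rewrite [RHS]ffunE [in RHS]ffunE.
  case: ifPn => [_|dt]; first by rewrite mulrC divfK.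
  by rewrite mulr1 pE.
Qed.

Lemma homogeneous_ideal_V_Mix :
  homogeneous_ideal (@V_Mix K) = ideal_generated [set binomial1; binomial2].
Proof.
apply: homogeneous_ideal_closure
  => [r [r0 [p [q [a [b [Xp [_ q0] _ _ rE]]]]]]|B n B1].
  split=> // f bf; have [_ /(_ f bf)] := segre_binomials p Xp.
  have r1 t : ~~ diagonal t -> r t = a * p t.
    by move=> dt; rewrite rE ffunE q0 // mulr0 addr0.
  case: bf => ->; rewrite (teval_binomial1, teval_binomial2) => h.
    rewrite teval_binomial1 !r1 //.
    by rewrite -[RHS](mulr0 (a ^+ 2)) -h; ring.
  rewrite teval_binomial2 !r1 //.
  by rewrite -[RHS](mulr0 (a ^+ 2)) -h; ring.
split; first exact: monomial_curve_neq0.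
have [p [Xp _ pE p000]] := monomial_curve_segre B n B1.
(* The difference is diagonal since [p] agrees with the curve elsewhere, and nonzero because of its
   entry at [(0, 0, 0)]. *)
exists p, (monomial_curve B n - p), 1, 1.
split; rewrite ?oner_neq0 //; first split.
- by rewrite subr_eq0; apply: contraNneq p000 => ->.
- by move=> t dt; rewrite !ffunE pE // ffunE subrr.
- by apply/ffunP => t; rewrite [RHS]ffunE !mul1r !ffunE addrC subrK.
Qed.

End VanishingIdeal.

Theorem proposition4p1 (R : realType) :
  let P := @Pvar R[i] in
  let b1 := P 0 1 0 * P 1 0 1 - P 0 0 1 * P 1 1 0 in
  let b2 := P 0 1 1 * P 1 0 0 - P 0 1 0 * P 1 0 1 in
  [/\ homogeneous_ideal (@V_QI R[i]) = homogeneous_ideal (@V_Mix R[i]),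
      homogeneous_ideal (@V_QI R[i]) = ideal_generated [set b1; b2],
      homogeneous_ideal (@segre R[i]) b1
    & homogeneous_ideal (@segre R[i]) b2].
Proof.
move=> P b1 b2; split.
- exact: etrans (homogeneous_ideal_V_QI _) (esym (homogeneous_ideal_V_Mix _)).
- exact: homogeneous_ideal_V_QI.
- by apply: segre_ideal_binomials; left.
- by apply: segre_ideal_binomials; right.
Qed.
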